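(* Let $(T_L,T_R)$, $(U_L,U_R)$, $(V_L,V_R)$ be pairs of unlabelled binary trees. For an element $w$ of the Baxter monoid $\mathrm{baxt}$ with $\mathrm{Sh}(\mathrm{P}(w)) = (T_L,T_R)$, let $N(w)$ be the number of pairs $(s,t) \in \mathrm{baxt}\times\mathrm{baxt}$ such that $st = w$, $\mathrm{Sh}(\mathrm{P}(s)) = (U_L,U_R)$ and $\mathrm{Sh}(\mathrm{P}(t)) = (V_L,V_R)$. Then $N(w)$ depends only on $(T_L,T_R)$, $(U_L,U_R)$ and $(V_L,V_R)$, and not on the content of $w$.
   Context: $\mathcal{A} = \{1,2,3,\ldots\}$ with the usual order; $\mathcal{A}^*$ the free monoid over $\mathcal{A}$. $\mathrm{rtree}(a_1\cdots a_k)$ is the right strict binary search tree obtained from the empty tree by inserting $a_k,\ldots,a_1$ in turn, where inserting $a$ creates a node at an empty position and otherwise recurses into the left subtree if $a \le$ root label, into the right subtree otherwise. $\mathrm{ltree}(a_1\cdots a_k)$ is the left strict binary search tree obtained from the empty tree by inserting $a_1,\ldots,a_k$ in turn, where inserting $a$ recurses into the right subtree if $a \ge$ root label and into the left subtree otherwise. The Baxter congruence: $u \equiv_{\mathrm{baxt}} v$ iff $\mathrm{ltree}(u)=\mathrm{ltree}(v)$ and $\mathrm{rtree}(u)=\mathrm{rtree}(v)$; it is a congruence and $\mathrm{baxt} = \mathcal{A}^*/{\equiv_{\mathrm{baxt}}}$. For $s \in \mathrm{baxt}$ represented by a word $u$, $\mathrm{P}(s) = (\mathrm{ltree}(u),\mathrm{rtree}(u))$,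 and $\mathrm{Sh}(\mathrm{P}(s))$ is the pair of underlying unlabelled rooted binary trees. *)

(* Defs.v *)
From HB Require Import structures.
From mathcomp Require Import all_boot.
From mathcomp Require Import boolp classical_sets cardinality.

Set Implicit Arguments.
Unset Strict Implicit.
Unset Printing Implicit Defensive.

Local Open Scope quotient_scope.

Definition letter := {n : nat | 0 < n}.

Notation word := (seq letter).

Inductive tree := Leaf | Node of tree & letter & tree.

Inductive bintree := BLeaf | BNode of bintree & bintree.

Fixpoint Sh (t : tree) : bintree :=
  if t is Node l _ r then BNode (Sh l) (Sh r) else BLeaf.

Definition tree_comparable : comparable tree.
Proof. by move=> s t; rewrite /decidable; decide equality; apply: eq_comparable. Defined.
HB.instance Definition _ := hasDecEq.Build tree (compareP tree_comparable).

Fixpoint rinsert (a : letter) (t : tree) : tree :=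
  if t is Node l b r then
    if val a <= val b then Node (rinsert a l) b r else Node l b (rinsert a r)
  else Node Leaf a Leaf.

Fixpoint linsert (a : letter) (t : tree) : tree :=
  if t is Node l b r then
    if val a >= val b then Node l b (linsert a r) else Node (linsert a l) b r
  else Node Leaf a Leaf.

(* [foldr] inserts the last letter of the word first. *)
Definition rtree (u : word) : tree := foldr rinsert Leaf u.

Definition ltree (u : word) : tree := foldl (fun t a => linsert a t) Leaf u.

Definition baxt_eq (u v : word) : bool :=
  (ltree u == ltree v) && (rtree u == rtree v).

Lemma baxt_eq_refl : reflexive baxt_eq.
Proof. by move=> u; rewrite /baxt_eq !eqxx. Qed.

Lemma baxt_eq_sym : symmetric baxt_eq.
Proof. by move=> u v; rewrite /baxt_eq eq_sym [rtree u == _]eq_sym. Qed.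

Lemma baxt_eq_trans : transitive baxt_eq.
Proof. by move=> v u w /andP[/eqP El /eqP Er]; rewrite /baxt_eq El Er. Qed.

Canonical baxt_equiv := EquivRel baxt_eq baxt_eq_refl baxt_eq_sym baxt_eq_trans.

(* Compatibility with concatenation: inserting a word below a node with label b
   inserts its letters < b and >= b (resp. <= b and > b) separately, and the
   insertion tree of such a subword is obtained by cutting the insertion tree
   of the word; [cutl p] keeps an initial segment [p] of the order, [cutr p] a
   final one. *)
Fixpoint cutl (p : pred letter) (t : tree) : tree :=
  if t is Node l b r then
    if p b then Node l b (cutl p r) else cutl p l
  else Leaf.

Fixpoint cutr (p : pred letter) (t : tree) : tree :=
  if t is Node l b r then
    if p b then Node (cutr p l) b r else cutr p r
  else Leaf.

Definition downset (p : pred letter) :=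
  forall a b : letter, val a <= val b -> p b -> p a.
Definition upset (p : pred letter) :=
  forall a b : letter, val a <= val b -> p a -> p b.

Lemma cutl_linsert p a t : downset p ->
  cutl p (linsert a t) = if p a then linsert a (cutl p t) else cutl p t.
Proof.
move=> dp; elim: t => [|l IHl b r IHr] /=; first by case: (p a).
have [ba|ab] := leqP (val b) (val a); rewrite /= ?IHl ?IHr.
  have := dp b a ba; case: (p a); case: (p b) => //= [] H; rewrite ?ba //.
  by have := H isT.
have := dp a b (ltnW ab); case: (p a); case: (p b) => //= [] H; rewrite 1?leqNgt ?ab //.
by have := H isT.
Qed.

Lemma cutr_linsert p a t : upset p ->
  cutr p (linsert a t) = if p a then linsert a (cutr p t) else cutr p t.
Proof.
move=> dp; elim: t => [|l IHl b r IHr] /=; first by case: (p a).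
have [ba|ab] := leqP (val b) (val a); rewrite /= ?IHl ?IHr.
  have := dp b a ba; case: (p a); case: (p b) => //= [] H; rewrite ?ba //.
  by have := H isT.
have := dp a b (ltnW ab); case: (p a); case: (p b) => //= [] H; rewrite 1?leqNgt ?ab //.
by have := H isT.
Qed.

Lemma cutl_rinsert p a t : downset p ->
  cutl p (rinsert a t) = if p a then rinsert a (cutl p t) else cutl p t.
Proof.
move=> dp; elim: t => [|l IHl b r IHr] /=; first by case: (p a).
have [ab|ba] := leqP (val a) (val b); rewrite /= ?IHl ?IHr.
  have := dp a b ab; case: (p a); case: (p b) => //= [] H; rewrite ?ab //.
  by have := H isT.
have := dp b a (ltnW ba); case: (p a); case: (p b) => //= [] H; rewrite 1?leqNgt ?ba //.
by have := H isT.
Qed.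

Lemma cutr_rinsert p a t : upset p ->
  cutr p (rinsert a t) = if p a then rinsert a (cutr p t) else cutr p t.
Proof.
move=> dp; elim: t => [|l IHl b r IHr] /=; first by case: (p a).
have [ab|ba] := leqP (val a) (val b); rewrite /= ?IHl ?IHr.
  have := dp a b ab; case: (p a); case: (p b) => //= [] H; rewrite ?ab //.
  by have := H isT.
have := dp b a (ltnW ba); case: (p a); case: (p b) => //= [] H; rewrite 1?leqNgt ?ba //.
by have := H isT.
Qed.

Lemma ltree_rcons u a : ltree (rcons u a) = linsert a (ltree u).
Proof. by rewrite /ltree -cats1 foldl_cat. Qed.

Lemma ltree_filterl p u : downset p -> ltree (filter p u) = cutl p (ltree u).
Proof.
move=> dp; elim/last_ind: u => // u a IHu.
rewrite filter_rcons ltree_rcons cutl_linsert // -IHu.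
by case: (p a); rewrite ?ltree_rcons.
Qed.

Lemma ltree_filterr p u : upset p -> ltree (filter p u) = cutr p (ltree u).
Proof.
move=> dp; elim/last_ind: u => // u a IHu.
rewrite filter_rcons ltree_rcons cutr_linsert // -IHu.
by case: (p a); rewrite ?ltree_rcons.
Qed.

Lemma rtree_filterl p u : downset p -> rtree (filter p u) = cutl p (rtree u).
Proof.
move=> dp; rewrite /rtree; elim: u => //= a u IHu.
by rewrite cutl_rinsert // -IHu; case: (p a).
Qed.

Lemma rtree_filterr p u : upset p -> rtree (filter p u) = cutr p (rtree u).
Proof.
move=> dp; rewrite /rtree; elim: u => //= a u IHu.
by rewrite cutr_rinsert // -IHu; case: (p a).
Qed.

Lemma foldl_linsert l b r u :
  foldl (fun t a => linsert a t) (Node l b r) u =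
  Node (foldl (fun t a => linsert a t) l [seq a <- u | val a < val b]) b
       (foldl (fun t a => linsert a t) r [seq a <- u | val b <= val a]).
Proof. by elim: u l r => //= a u IHu l r; case: leqP => _; rewrite IHu. Qed.

Lemma foldr_rinsert l b r u :
  foldr rinsert (Node l b r) u =
  Node (foldr rinsert l [seq a <- u | val a <= val b]) b
       (foldr rinsert r [seq a <- u | val b < val a]).
Proof. by elim: u => //= a u ->/=; case: leqP. Qed.

Lemma foldl_linsert_eq t u v : ltree u = ltree v ->
  foldl (fun t a => linsert a t) t u = foldl (fun t a => linsert a t) t v.
Proof.
elim: t u v => [|l IHl b r IHr] u v E //; rewrite !foldl_linsert.
congr Node.
  by apply: IHl; rewrite !ltree_filterl ?E // => a c; exact: leq_ltn_trans.
by apply: IHr; rewrite !ltree_filterr ?E // => a c ac /leq_trans; apply.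
Qed.

Lemma foldr_rinsert_eq t u v : rtree u = rtree v ->
  foldr rinsert t u = foldr rinsert t v.
Proof.
elim: t u v => [|l IHl b r IHr] u v E //; rewrite !foldr_rinsert.
congr Node.
  by apply: IHl; rewrite !rtree_filterl ?E // => a c; exact: leq_trans.
by apply: IHr; rewrite !rtree_filterr ?E // => a c ac /leq_trans; apply.
Qed.

Lemma baxt_eq_cat u u' v v' :
  baxt_eq u u' -> baxt_eq v v' -> baxt_eq (u ++ v) (u' ++ v').
Proof.
move=> /andP[/eqP lu /eqP ru] /andP[/eqP lv /eqP rv].
rewrite /baxt_eq /ltree /rtree !foldl_cat !foldr_cat.
rewrite -!/(ltree _) -!/(rtree _) lu rv.
by apply/andP; split; apply/eqP; [exact: foldl_linsert_eq | exact: foldr_rinsert_eq].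
Qed.

Definition baxt := {eq_quot baxt_equiv}.
HB.instance Definition _ := Choice.on baxt.
HB.instance Definition _ := EqQuotient.on baxt.

Definition baxt_mul : baxt -> baxt -> baxt := lift_op2 baxt (@cat letter).

Lemma pi_baxt_mul : {morph \pi_baxt : u v / u ++ v >-> baxt_mul u v}.
Proof.
move=> u v; unlock baxt_mul; apply/eqP; rewrite piE.
by apply: baxt_eq_cat; rewrite -[baxt_eq _ _]/(baxt_equiv _ _) -eqmodE reprK.
Qed.

Lemma baxt_mulA : associative baxt_mul.
Proof.
by move=> x y z; rewrite -[x]reprK -[y]reprK -[z]reprK -!pi_baxt_mul catA.
Qed.

Lemma baxt_mul1s : left_id (\pi_baxt [::]) baxt_mul.
Proof. by move=> x; rewrite -[x]reprK -pi_baxt_mul. Qed.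

Lemma baxt_muls1 : right_id (\pi_baxt [::]) baxt_mul.
Proof. by move=> x; rewrite -[x]reprK -pi_baxt_mul cats0. Qed.

HB.instance Definition _ :=
  isMonoid.Build baxt baxt_mulA baxt_mul1s baxt_muls1.

Definition P (s : baxt) : tree * tree := (ltree (repr s), rtree (repr s)).

Lemma P_pi (u : word) : P (\pi_baxt u) = (ltree u, rtree u).
Proof.
have /andP[/eqP El /eqP Er] : baxt_eq (repr (\pi_baxt u)) u.
  by rewrite -[baxt_eq _ _]/(baxt_equiv _ _) -eqmodE reprK.
by rewrite /P El Er.
Qed.

Definition Sh2 (p : tree * tree) : bintree * bintree := (Sh p.1, Sh p.2).

Local Open Scope classical_set_scope.

Definition factorizations (U V : bintree * bintree) (w : baxt) : set (baxt * baxt) :=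
  [set st : baxt * baxt |
    [/\ (st.1 * st.2)%g = w, Sh2 (P st.1) = U & Sh2 (P st.2) = V]].

(* Main.v *)
Require Import Defs.
From mathcomp Require Import all_boot.
From mathcomp Require Import classical_sets cardinality.

(* Two words of the same length are order-isomorphic when their letters in
   positions i < j always compare alike under <=; this is equality of
   standardizations, and it preserves the shapes of both insertion trees. An
   element of baxt is determined by its shapes and its content.
   If w and w' have the same shapes, any word for w is order-isomorphic to some
   word for w'; cutting both words at the same place transports factorizations
   of w to factorizations of w' with the same shapes. The transport is
   injective: the pairs of matched letters are totally ordered by the product
   order, so their multiset depends only on the contents of w and w', and
   matched letters sharing one component occur in increasing order of the other
   one, so the pairs lying in the left factor depend only on its content.
   Exchanging w and w' gives equality of the cardinals. *)

Set Implicit Arguments.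
Unset Strict Implicit.
Unset Printing Implicit Defensive.

Local Open Scope quotient_scope.
Local Open Scope classical_set_scope.
Local Open Scope card_scope.

(** * Inorder readings and the content of a class *)

Definition letter_le : rel letter := fun a b => val a <= val b.

Lemma letter_le_trans : transitive letter_le.
Proof. by move=> b a c; apply: leq_trans. Qed.

Lemma letter_le_anti : antisymmetric letter_le.
Proof. by move=> a b; rewrite -eqn_leq => /eqP /val_inj. Qed.

Fixpoint inorder (t : tree) : word :=
  if t is Node l a r then inorder l ++ a :: inorder r else [::].

Lemma ltree_cons a u :
  ltree (a :: u) = Node (ltree [seq b <- u | val b < val a]) a
                        (ltree [seq b <- u | val a <= val b]).
Proof. by rewrite /ltree /= foldl_linsert. Qed.

Lemma rtree_rcons u a :
  rtree (rcons u a) = Node (rtree [seq b <- u | val b <= val a]) a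
                           (rtree [seq b <- u | val a < val b]).
Proof. by rewrite /rtree foldr_rcons /= foldr_rinsert. Qed.

Lemma perm_inorder_linsert a t : perm_eq (inorder (linsert a t)) (a :: inorder t).
Proof.
elim: t => [|l IHl b r IHr] //=; case: ifP => _ /=; last first.
  by rewrite -cat_cons perm_cat2r.
rewrite perm_sym -cat1s perm_catCA perm_cat2l /= -cat1s -(cat1s b).
by rewrite perm_catCA perm_cat2l perm_sym.
Qed.

Lemma perm_inorder_rinsert a t : perm_eq (inorder (rinsert a t)) (a :: inorder t).
Proof.
elim: t => [|l IHl b r IHr] //=; case: ifP => _ /=.
  by rewrite -cat_cons perm_cat2r.
rewrite perm_sym -cat1s perm_catCA perm_cat2l /= -cat1s -(cat1s b).
by rewrite perm_catCA perm_cat2l perm_sym.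
Qed.

Lemma perm_inorder_ltree u : perm_eq (inorder (ltree u)) u.
Proof.
elim/last_ind: u => // u a IHu; rewrite ltree_rcons.
by rewrite (permPl (perm_inorder_linsert _ _)) perm_sym perm_rcons perm_cons perm_sym.
Qed.

Lemma perm_inorder_rtree u : perm_eq (inorder (rtree u)) u.
Proof.
elim: u => //= a u IHu.
by rewrite (permPl (perm_inorder_rinsert _ _)) perm_cons.
Qed.

Lemma ltree_perm {u v} : ltree u = ltree v -> perm_eq u v.
Proof.
by move=> E; rewrite -(permPl (perm_inorder_ltree u)) E perm_inorder_ltree.
Qed.

Lemma inorder_node_sorted l a r :
  sorted letter_le (inorder l) -> sorted letter_le (inorder r) ->
  {in inorder l, forall b, letter_le b a} ->
  {in inorder r, forall b, letter_le a b} ->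
  sorted letter_le (inorder (Node l a r)).
Proof.
have tr := letter_le_trans.
rewrite !sorted_pairwise //= pairwise_cat pairwise_cons => -> -> la ar /=.
rewrite !andbT; apply/andP; split; last by apply/allP.
apply/allrelP => b c bl; rewrite inE => /predU1P[->|cr]; first exact: la.
exact: tr (la _ bl) (ar _ cr).
Qed.

Lemma ltree_sorted u : sorted letter_le (inorder (ltree u)).
Proof.
have [n] := ubnP (size u); elim: n u => // n IHn [|a u] // /ltnSE le_u.
rewrite ltree_cons; apply: inorder_node_sorted.
- by apply: IHn; apply: leq_ltn_trans le_u; rewrite size_filter count_size.
- by apply: IHn; apply: leq_ltn_trans le_u; rewrite size_filter count_size.
- move=> b; rewrite (perm_mem (perm_inorder_ltree _)) mem_filter => /andP[+ _].
  exact: ltnW.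
- by move=> b; rewrite (perm_mem (perm_inorder_ltree _)) mem_filter => /andP[].
Qed.

Lemma rtree_sorted u : sorted letter_le (inorder (rtree u)).
Proof.
have [n] := ubnP (size u); elim: n u => // n IHn u.
case/lastP: u => // u a; rewrite size_rcons => /ltnSE le_u.
rewrite rtree_rcons; apply: inorder_node_sorted.
- by apply: IHn; apply: leq_ltn_trans le_u; rewrite size_filter count_size.
- by apply: IHn; apply: leq_ltn_trans le_u; rewrite size_filter count_size.
- by move=> b; rewrite (perm_mem (perm_inorder_rtree _)) mem_filter => /andP[].
- move=> b; rewrite (perm_mem (perm_inorder_rtree _)) mem_filter => /andP[+ _].
  exact: ltnW.
Qed.

(** Equal shapes give left subtrees of equal size, so equal inorder words split at the same place
    around the root. *)
Lemma Sh_inorder_inj t t' : Sh t = Sh t' -> inorder t = inorder t' -> t = t'.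
Proof.
have size_inorder s s' : Sh s = Sh s' -> size (inorder s) = size (inorder s').
  elim: s s' => [|l IHl a r IHr] [|l' a' r'] //= [El Er].
  by rewrite !size_cat /= (IHl _ El) (IHr _ Er).
elim: t t' => [|l IHl a r IHr] [|l' a' r'] //= [El Er] /eqP.
rewrite eqseq_cat ?(size_inorder _ _ El) // => /andP[/eqP Il /eqP[-> Ir]].
by rewrite (IHl _ El Il) (IHr _ Er Ir).
Qed.

(** Inorder readings are sorted rearrangements of the word, so content and shapes recover both
    trees. *)
Lemma baxt_eq_Sh_perm u v :
  Sh (ltree u) = Sh (ltree v) -> Sh (rtree u) = Sh (rtree v) -> perm_eq u v ->
  baxt_eq u v.
Proof.
move=> El Er uv; apply/andP.
split; apply/eqP; apply: Sh_inorder_inj => //;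
  apply: (sorted_eq letter_le_trans letter_le_anti);
  rewrite ?ltree_sorted ?rtree_sorted //.
- by rewrite (permPl (perm_inorder_ltree u)) perm_sym (permPl (perm_inorder_ltree v)) perm_sym.
- by rewrite (permPl (perm_inorder_rtree u)) perm_sym (permPl (perm_inorder_rtree v)) perm_sym.
Qed.

(** * Order-isomorphic words and insertion shapes *)

(* A pair of order-isomorphic words is encoded as a single word of pairs [p],
   with [pairwise same_le p]; the words are [unzip1 p] and [unzip2 p]. *)
Definition same_le : rel (letter * letter) :=
  fun x y => (val x.1 <= val y.1) == (val x.2 <= val y.2).

Lemma unzip1_filter (c : pred letter) (p : seq (letter * letter)) :
  [seq a <- unzip1 p | c a] = unzip1 [seq x <- p | c x.1].
Proof. by rewrite /unzip1 filter_map. Qed.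

Lemma unzip2_filter (c : pred letter) (p : seq (letter * letter)) :
  [seq a <- unzip2 p | c a] = unzip2 [seq x <- p | c x.2].
Proof. by rewrite /unzip2 filter_map. Qed.

(** The first letter is the root, and [same_le] sends the same positions of both words into each
    subtree. The induction is on size because subtrees are built from filtered words. *)
Lemma same_le_ltree p : pairwise same_le p ->
  Sh (ltree (unzip1 p)) = Sh (ltree (unzip2 p)).
Proof.
have [n] := ubnP (size p); elim: n p => // n IHn [|x p] // /ltnSE le_p.
rewrite [pairwise _ _]/= => /andP[/allP xp pp].
rewrite ![_ (x :: p)]/= !ltree_cons /= !unzip1_filter !unzip2_filter.
have E y : y \in p -> (val x.1 <= val y.1) = (val x.2 <= val y.2) by move=> /xp /eqP.
have -> : [seq y <- p | val y.2 < val x.2] = [seq y <- p | val y.1 < val x.1].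
  by apply: eq_in_filter => y /E; rewrite !ltnNge => ->.
have -> : [seq y <- p | val x.2 <= val y.2] = [seq y <- p | val x.1 <= val y.1].
  by apply: eq_in_filter => y /E ->.
by congr BNode; apply: IHn; rewrite ?pairwise_filter //;
  apply: leq_ltn_trans le_p; rewrite size_filter count_size.
Qed.

Lemma same_le_rtree p : pairwise same_le p ->
  Sh (rtree (unzip1 p)) = Sh (rtree (unzip2 p)).
Proof.
have [n] := ubnP (size p); elim: n p => // n IHn p.
case/lastP: p => // p x; rewrite size_rcons => /ltnSE le_p.
rewrite pairwise_rcons => /andP[/allP xp pp].
rewrite /unzip1 /unzip2 !map_rcons -/(unzip1 p) -/(unzip2 p) !rtree_rcons /=.
rewrite !unzip1_filter !unzip2_filter.
have E y : y \in p -> (val y.1 <= val x.1) = (val y.2 <= val x.2) by move=> /xp /eqP.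
have -> : [seq y <- p | val x.2 < val y.2] = [seq y <- p | val x.1 < val y.1].
  by apply: eq_in_filter => y /E; rewrite !ltnNge => ->.
have -> : [seq y <- p | val y.2 <= val x.2] = [seq y <- p | val y.1 <= val x.1].
  by apply: eq_in_filter => y /E ->.
by congr BNode; apply: IHn; rewrite ?pairwise_filter //;
  apply: leq_ltn_trans le_p; rewrite size_filter count_size.
Qed.

(** Serves to merge the matchings found for two subtrees into one that follows the positions of
    [u]. *)
Lemma shuffle_unzip1 (c : pred letter) (u : word) (p q : seq (letter * letter)) :
  unzip1 p = [seq a <- u | c a] -> unzip1 q = [seq a <- u | ~~ c a] ->
  exists r, [/\ unzip1 r = u, [seq x <- r | c x.1] = p
                            & [seq x <- r | ~~ c x.1] = q].
Proof.
elim: u p q => [|a u IHu] p q /=; first by case: p q => [|? ?] [|? ?] // _ _; exists [::].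
case ca: (c a) => /=.
  case: p => [//|[a' b] p] /= [-> {a'} Ep] Eq.
  have [r [<- <- <-]] := IHu _ _ Ep Eq.
  by exists ((a, b) :: r); rewrite /= ca.
move=> Ep; case: q => [//|[a' b] q] /= [-> {a'} Eq].
have [r [<- <- <-]] := IHu _ _ Ep Eq.
by exists ((a, b) :: r); rewrite /= ca.
Qed.

Lemma pairwise_filterC (T : eqType) (R : rel T) (c : pred T) (s : seq T) :
  pairwise R (filter c s) -> pairwise R (filter (predC c) s) ->
  {in s &, forall x y, c x != c y -> R x y} -> pairwise R s.
Proof.
elim: s => //= x s IHs p1 p2 cR.
have IH : pairwise R s.
  apply: IHs; last by move=> y z ys zs; apply: cR; rewrite inE ?ys ?zs orbT.
    by case: (c x) p1 => //= /andP[].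
  by case: (c x) p2 => //= /andP[].
rewrite IH andbT; apply/allP => y ys.
have [E|/cR] := eqVneq (c x) (c y); last by apply; rewrite !inE ?eqxx ?ys ?orbT.
case cx: (c x) E p1 p2 => /= /esym cy.
  by move=> /andP[/allP + _] _; apply; rewrite mem_filter cy.
by move=> _ /andP[/allP + _]; apply; rewrite mem_filter /= cy.
Qed.

(** Roots are matched with each other, the subwords feeding the subtrees are matched recursively,
    and the matchings are interleaved as in [u]. *)
Lemma same_le_lift u v : Sh (ltree u) = Sh (ltree v) ->
  exists p, [/\ unzip1 p = u, pairwise same_le p & ltree (unzip2 p) = ltree v].
Proof.
have [n] := ubnP (size u); elim: n u v => // n IHn [|a u] [|b v] //.
- by exists [::].
- by rewrite ltree_cons.
- by rewrite ltree_cons.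
move=> /ltnSE le_u; rewrite !ltree_cons => -[El Er].
have lt_filter c : size (filter c u) < n.
  by apply: leq_ltn_trans le_u; rewrite size_filter count_size.
have [p [Ep pp lp]] := IHn _ _ (lt_filter _) El.
have [q [Eq pq lq]] := IHn _ _ (lt_filter _) Er.
have Eq' : unzip1 q = [seq c <- u | ~~ (val c < val a)].
  by rewrite Eq; apply: eq_filter => c; rewrite -leqNgt.
have [r [Eu rp rq]] := shuffle_unzip1 Ep Eq'.
(* Equal trees have equal contents, so the second components of [p] are the letters of [v] below
   [b]. *)
have lt_p x : x \in p -> val x.2 < val b.
  move=> xp; have: x.2 \in unzip2 p by apply: map_f.
  by rewrite (perm_mem (ltree_perm lp)) mem_filter => /andP[].
have ge_q x : x \in q -> val b <= val x.2.
  move=> xq; have: x.2 \in unzip2 q by apply: map_f.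
  by rewrite (perm_mem (ltree_perm lq)) mem_filter => /andP[].
have lt_ab x : x \in r -> (val x.1 < val a) = (val x.2 < val b).
  move=> xr; case xa: (val x.1 < val a).
    by rewrite lt_p // -rp mem_filter xa.
  by rewrite ltnNge ge_q // -rq mem_filter xa.
exists ((a, b) :: r); split; first by rewrite /= Eu.
  rewrite /=; apply/andP; split.
    by apply/allP => x /lt_ab; rewrite /same_le /= !ltnNge => /negb_inj ->.
  apply: (@pairwise_filterC _ _ (fun x => val x.1 < val a)).
  - by rewrite rp.
  - by rewrite [filter _ _]rq.
  (* Pairs on opposite sides of the roots compare alike in both components. *)
  move=> x y xr yr; rewrite /same_le.
  have := lt_ab _ xr; have := lt_ab _ yr.
  case: (ltnP (val x.1)) => xa; case: (ltnP (val y.1)) => ya // /esym yb /esym xb _.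
    have {}yb : val b <= val y.2 by rewrite leqNgt yb.
    by rewrite (ltnW (leq_trans xa ya)) (ltnW (leq_trans xb yb)).
  have {}xb : val b <= val x.2 by rewrite leqNgt xb.
  by rewrite leqNgt (leq_trans ya xa) [in X in _ == X]leqNgt (leq_trans yb xb).
(* Cutting the second word at [b] gives back [p] and [q], whose trees are the subtrees for [v]. *)
have rp2 : [seq x <- r | val x.2 < val b] = p.
  by rewrite -rp; apply: eq_in_filter => x /lt_ab.
have rq2 : [seq x <- r | val b <= val x.2] = q.
  rewrite -rq; apply: eq_in_filter => x /lt_ab.
  by rewrite -leqNgt !ltnNge => /negb_inj.
by rewrite /= ltree_cons !unzip2_filter rp2 rq2 lp lq.
Qed.

(** * Matched pairs determined by contents *)

Definition prod_le : rel (letter * letter) :=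
  fun x y => letter_le x.1 y.1 && letter_le x.2 y.2.

(** If [<=] fails, it fails in both components at once, which reverses the pair in the product
    order. *)
Lemma same_le_total p : pairwise same_le p -> {in p &, total prod_le}.
Proof.
elim: p => //= z p IHp /andP[/allP zp pp].
have cmp y : y \in p -> prod_le z y || prod_le y z.
  move=> /zp /eqP; rewrite /prod_le /letter_le; case: leqP => zy /esym.
    by move=> ->.
  by move=> /negbT; rewrite -ltnNge => /ltnW ->; rewrite (ltnW zy).
have refl y : prod_le y y by rewrite /prod_le /letter_le !leqnn.
move=> x y; rewrite !inE => /predU1P[->|xp] /predU1P[->|yp].
- by rewrite refl.
- exact: cmp.
- by rewrite orbC cmp.
- exact: IHp.
Qed.

(** Once the pairs are sorted by the product order, each list of components is sorted and so depends
    only on its content. *)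
Lemma same_le_perm p q : pairwise same_le p -> pairwise same_le q ->
  perm_eq (unzip1 p) (unzip1 q) -> perm_eq (unzip2 p) (unzip2 q) -> perm_eq p q.
Proof.
have tr : transitive prod_le.
  move=> y x z /andP[a b] /andP[c d]; apply/andP.
  by split; [apply: letter_le_trans a c | apply: letter_le_trans b d].
have sorted_sort r : pairwise same_le r -> sorted prod_le (sort prod_le r).
  by move=> /same_le_total tot; apply: (sort_sorted_in tot); apply/allP.
move=> pp pq E1 E2; rewrite -(perm_sort prod_le) perm_sym -(perm_sort prod_le).
suff -> : sort prod_le p = sort prod_le q by [].
have unzip_eq (f : letter * letter -> letter) :
    {homo f : x y / prod_le x y >-> letter_le x y} ->
    perm_eq (map f p) (map f q) ->
    map f (sort prod_le p) = map f (sort prod_le q).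
  move=> hf Ef; apply: (sorted_eq letter_le_trans letter_le_anti).
  - exact: homo_sorted (sorted_sort _ pp).
  - exact: homo_sorted (sorted_sort _ pq).
  rewrite (permPl (perm_map f (permEl (perm_sort _ _)))).
  by rewrite (permPl Ef) perm_sym; apply/perm_map/permEl/perm_sort.
rewrite -(zip_unzip (sort prod_le p)) -(zip_unzip (sort prod_le q)).
by congr zip; apply: unzip_eq => // x y /andP[].
Qed.

(* The pairs with second component [a] occur in increasing order of the first
   component, so those in [px] form a prefix of known length. *)
Lemma same_le_perm_cat px py qx qy :
  pairwise same_le (px ++ py) -> pairwise same_le (qx ++ qy) ->
  perm_eq (px ++ py) (qx ++ qy) -> perm_eq (unzip2 px) (unzip2 qx) ->
  perm_eq px qx.
Proof.
move=> pp pq pq_perm E2.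
have sorted_level r a : pairwise same_le r ->
    sorted letter_le (unzip1 [seq x <- r | x.2 == a]).
  move=> pr; rewrite sorted_map.
  have sub : {in [pred x | x.2 == a] &, subrel same_le (relpre fst letter_le)}.
    by move=> x y /eqP xa /eqP ya; rewrite /same_le xa ya leqnn => /eqP.
  apply/pairwise_sorted/(sub_in_pairwise sub); first exact: filter_all.
  exact: pairwise_filter.
have level_eq a : [seq x <- px | x.2 == a] = [seq x <- qx | x.2 == a].
  have : [seq x <- px ++ py | x.2 == a] = [seq x <- qx ++ qy | x.2 == a].
    (* First components are sorted with equal content; second components are constantly [a]. *)
    rewrite -(zip_unzip (filter _ (px ++ py))) -(zip_unzip (filter _ (qx ++ qy))).
    have perm_level := perm_filter (fun x => x.2 == a) pq_perm.
    congr zip.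
      apply: (sorted_eq letter_le_trans letter_le_anti);
        [exact: sorted_level | exact: sorted_level | exact: perm_map].
    have const (r : seq (letter * letter)) :
        unzip2 [seq x <- r | x.2 == a] = nseq (size [seq x <- r | x.2 == a]) a.
      by elim: r => //= x r IHr; case: eqP => //= ->; rewrite IHr.
    by rewrite !const (perm_size perm_level).
  rewrite !filter_cat => /eqP; rewrite eqseq_cat; first by case/andP=> /eqP.
  have count_level (r : seq (letter * letter)) :
      size [seq x <- r | x.2 == a] = count_mem a (unzip2 r).
    by rewrite size_filter count_map.
  by rewrite !count_level; apply/permP.
apply/allP => x _ /=; apply/eqP.
have count_level (r : seq (letter * letter)) :
    count_mem x r = count_mem x [seq y <- r | y.2 == x.2].
  by rewrite count_filter; apply: eq_count => y /=; case: eqP => // ->; rewrite eqxx.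
by rewrite count_level level_eq -count_level.
Qed.

(** * Passage from words to classes *)

Lemma baxt_piP (u v : word) : reflect (\pi_baxt u = \pi_baxt v) (baxt_eq u v).
Proof. by rewrite -[baxt_eq _ _]/(baxt_equiv _ _) -eqmodE; apply: eqP. Qed.

Lemma Sh2_pi (u : word) : Sh2 (P (\pi_baxt u)) = (Sh (ltree u), Sh (rtree u)).
Proof. by rewrite P_pi. Qed.

Lemma same_le_Sh2 p : pairwise same_le p ->
  Sh2 (P (\pi_baxt (unzip1 p))) = Sh2 (P (\pi_baxt (unzip2 p))).
Proof. by move=> pp; rewrite !Sh2_pi same_le_ltree // same_le_rtree. Qed.

Lemma pi_eq_Sh2_perm (u v : word) :
  Sh2 (P (\pi_baxt u)) = Sh2 (P (\pi_baxt v)) -> perm_eq u v ->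
  \pi_baxt u = \pi_baxt v.
Proof. by rewrite !Sh2_pi => -[El Er] uv; apply/baxt_piP/baxt_eq_Sh_perm. Qed.

Lemma pi_eq_perm (u v : word) : \pi_baxt u = \pi_baxt v -> perm_eq u v.
Proof. by move=> /baxt_piP/andP[/eqP /ltree_perm]. Qed.

(** The lift fixes only the left tree, hence the content; order isomorphism supplies the right
    shape, and together they determine the class. *)
Lemma pi_same_le_lift (u v : word) :
  Sh2 (P (\pi_baxt u)) = Sh2 (P (\pi_baxt v)) ->
  exists p, [/\ unzip1 p = u, pairwise same_le p
              & \pi_baxt (unzip2 p) = \pi_baxt v].
Proof.
move=> E; have /same_le_lift[p [Ep pp lp]] : Sh (ltree u) = Sh (ltree v).
  by move: E; rewrite !Sh2_pi => -[].
exists p; split=> //; apply: pi_eq_Sh2_perm (ltree_perm lp).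
by rewrite -same_le_Sh2 // Ep.
Qed.

(** * Transport of factorizations *)

Definition same_le_factors (st st' : baxt * baxt) : Prop :=
  exists p q, [/\ pairwise same_le (p ++ q),
    st = (\pi_baxt (unzip1 p), \pi_baxt (unzip1 q))
    & st' = (\pi_baxt (unzip2 p), \pi_baxt (unzip2 q))].

(** The word [repr s ++ repr t] for [w] is lifted to a word for [w'], and both are cut after
    [size (repr s)] letters. *)
Lemma same_le_factors_total U V w w' st : Sh2 (P w) = Sh2 (P w') ->
  factorizations U V w st ->
  exists2 st', factorizations U V w' st' & same_le_factors st st'.
Proof.
case: st => s t Ew [/= Est Us Vt].
have Er : Sh2 (P (\pi_baxt (repr s ++ repr t))) = Sh2 (P (\pi_baxt (repr w'))).
  by rewrite pi_baxt_mul !reprK -Ew -Est.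
have [p [Ep pp pw]] := pi_same_le_lift Er.
pose k := size (repr s).
have E1 : unzip1 (take k p) = repr s by rewrite /unzip1 map_take -/(unzip1 p) Ep take_size_cat.
have E2 : unzip1 (drop k p) = repr t by rewrite /unzip1 map_drop -/(unzip1 p) Ep drop_size_cat.
have := pp; rewrite -{1}(cat_take_drop k p) pairwise_cat => /and3P[_ p1 p2].
exists (\pi_baxt (unzip2 (take k p)), \pi_baxt (unzip2 (drop k p))).
  split=> /=.
  - have <- : \pi_baxt (unzip2 p) = w' by rewrite pw reprK.
    rewrite -[RHS]/(\pi_baxt (map snd p)) -{3}(cat_take_drop k p) map_cat.
    by rewrite pi_baxt_mul.
  - by rewrite -same_le_Sh2 // E1 reprK.
  - by rewrite -same_le_Sh2 // E2 reprK.
by exists (take k p), (drop k p); rewrite cat_take_drop E1 E2 !reprK.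
Qed.

Lemma same_le_factors_inj st1 st2 st' :
  (st1.1 * st1.2 = st2.1 * st2.2)%g ->
  same_le_factors st1 st' -> same_le_factors st2 st' -> st1 = st2.
Proof.
case: st1 st2 => [s1 t1] [s2 t2] /= E.
move=> [px [py [pp [Es1 Et1] ->]]] [qx [qy [pq [Es2 Et2] [Ex Ey]]]].
have perm1 : perm_eq (unzip1 (px ++ py)) (unzip1 (qx ++ qy)).
  apply: pi_eq_perm; rewrite /unzip1 !map_cat !pi_baxt_mul.
  by rewrite -Es1 -Et1 -Es2 -Et2.
rewrite Es1 Et1 Es2 Et2.
have perm_x := pi_eq_perm Ex; have perm_y := pi_eq_perm Ey.
have perm2 : perm_eq (unzip2 (px ++ py)) (unzip2 (qx ++ qy)).
  by rewrite /unzip2 !map_cat perm_cat.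
have perm_p := same_le_perm pp pq perm1 perm2.
have perm_px := same_le_perm_cat pp pq perm_p perm_x.
have perm_py : perm_eq py qy.
  by rewrite -(perm_cat2l qx) -(permPr perm_p) perm_cat2r perm_sym.
have := pp; have := pq.
rewrite !pairwise_cat => /and3P[_ pqx pqy] /and3P[_ ppx ppy].
(* Contents agree by [perm_px] and [perm_py]; shapes agree because both equal those of the common
   image [st']. *)
by congr pair; apply: pi_eq_Sh2_perm; rewrite ?perm_map // !same_le_Sh2 // ?Ex ?Ey.
Qed.

(** * Comparison of cardinals *)

Lemma card_le_factorizations U V w w' : Sh2 (P w) = Sh2 (P w') ->
  factorizations U V w #<= factorizations U V w'.
Proof.
move=> Ew; have tot st : exists st', factorizations U V w st ->
    factorizations U V w' st' /\ same_le_factors st st'.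
  have [/(same_le_factors_total Ew)[st' ? ?]|nst] := boolp.EM (factorizations U V w st).
    by exists st'.
  (* Outside the factorizations of [w], the choice function gets [st] as a default value. *)
  by exists st.
have [f fP] := boolp.choice tot.
have fI : {in factorizations U V w &, injective f}.
  move=> st1 st2 /set_mem F1 /set_mem F2 Ef.
  apply: (@same_le_factors_inj _ _ (f st1)).
  - by case: F1 => -> _ _; case: F2 => ->.
  - by have [] := fP _ F1.
  - by rewrite Ef; have [] := fP _ F2.
rewrite -(card_le_eql (inj_card_eq fI)); apply: subset_card_le.
by move=> _ [st /fP[Fst' _] <-].
Qed.

(** Turns equality of cardinals into a number: every factorization comes from cutting a
    rearrangement of [repr w]. *)
Lemma finite_factorizations U V w : finite_set (factorizations U V w).
Proof.
(* The cut positions include [size (repr w)], where the right factor is empty. *)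
pose cuts := [seq (\pi_baxt (take k z), \pi_baxt (drop k z))
  | z <- permutations (repr w), k <- iota 0 (size (repr w)).+1].
apply: (sub_finite_set _ (finite_seq cuts)) => -[s t] [/= Est _ _].
have perm_st : perm_eq (repr s ++ repr t) (repr w).
  by apply: pi_eq_perm; rewrite pi_baxt_mul !reprK.
apply/allpairsPdep; exists (repr s ++ repr t), (size (repr s)); split.
- by rewrite mem_permutations.
- by rewrite mem_iota leq0n add0n ltnS -(perm_size perm_st) size_cat leq_addr.
- by rewrite take_size_cat // drop_size_cat // !reprK.
Qed.

Theorem theorem5 (T_L T_R U_L U_R V_L V_R : bintree) :
  exists N : nat, forall w : baxt, Sh2 (P w) = (T_L, T_R) ->
    factorizations (U_L, U_R) (V_L, V_R) w #= `I_N.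
Proof.
have [[w0 E0]|none] := boolp.EM (exists w0, Sh2 (P w0) = (T_L, T_R)); last first.
  (* With no element of these shapes the claim is vacuous. *)
  by exists 0 => w Ew; case: none; exists w.
have [N cardN] := finite_factorizations (U_L, U_R) (V_L, V_R) w0.
exists N => w Ew; apply: card_eq_trans cardN.
by rewrite card_eq_le !card_le_factorizations // Ew E0.
Qed.
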